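(* In the setting of the context (translation invariant systems on periodic hypercubic lattices $\Lambda$ with $N$ sites, with long range order of $O_\Lambda$ in the ground state and a uniform gap above the two lowest eigenvalues), let $$\Psi_\Lambda:=\frac{O_\Lambda\Phi^{(0)}_\Lambda}{\|O_\Lambda\Phi^{(0)}_\Lambda\|},\qquad \Xi_\Lambda:=\frac1{\sqrt2}\left(\Phi^{(0)}_\Lambda+\Psi_\Lambda\right).$$ For a local self-adjoint operator $A$ and a subset $\Omega$ of the lattice put $A_\Omega:=\sum_{x\in\Omega}\tau_x(A)$. Then for any such $A$ $$\lim_{|\Omega|\uparrow\infty}\ \lim_{N\uparrow\infty}\frac1{|\Omega|^2}\left\{(\Xi_\Lambda,(A_\Omega)^2\,\Xi_\Lambda)-(\Xi_\Lambda,A_\Omega\,\Xi_\Lambda)^2\right\}=0,$$ where, if the inner limit does not exist, it is replaced by $\limsup_{N\uparrow\infty}$.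
   Context: $\Lambda$ ranges over $d$-dimensional hypercubic lattices with $N$ sites and periodic boundary conditions. To each site $x$ is associated a copy $\mathcal H_x$ of a fixed finite-dimensional Hilbert space; $\mathcal H_\Lambda=\bigotimes_{x\in\Lambda}\mathcal H_x$. $\tau_x$ is translation of operators by $x$ (respecting periodicity). $H_\Lambda=\sum_{x\in\Lambda}h_x$ and $O_\Lambda=\sum_{x\in\Lambda}o_x$, with $h_x=\tau_x(h_o)$ and $o_x=\tau_x(o_o)$, where $h_o$ and $o_o$ are self-adjoint, independent of $\Lambda$; $o_x$ acts only on $\mathcal H_x$ (so the $o_x$ commute with each other), and $h_x$ acts only on $\bigotimes_{y\in\mathcal S_x}\mathcal H_y$ for a set $\mathcal S_x$ of at most $r$ sites (so $[h_x,o_y]=0$ unless $y\in\mathcal S_x$). $\|h_x\|\le h$, $\|o_x\|\le o$. The constants $h,o>0$ and $r$ are independent of $\Lambda$. $E^{(0)}_\Lambda<E^{(1)}_\Lambda$ are the two lowest eigenvalues of $H_\Lambda$, both nondegenerate, with normalized eigenstates $\Phi^{(0)}_\Lambda,\Phi^{(1)}_\Lambda$, and any other eigenvalue $E'_\Lambda$ satisfies $E'_\Lambda-E^{(1)}_\Lambda\ge E_{\rm G}$ with a $\Lambda$-independent constant $E_{\rm G}>0$. The ground state satisfies $$(\Phi^{(0)}_\Lambda,O_\Lambda\Phi^{(0)}_\Lambda)=0,\quad (\Phi^{(0)}_\Lambda,(O_\Lambda)^2\Phi^{(0)}_\Lambda)\ge(\mu oN)^2,\quad (\Phi^{(0)}_\Lambda,(O_\Lambda)^3\Phi^{(0)}_\Lambda)=0$$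 with a $\Lambda$-independent constant $\mu>0$. A local operator is one acting on $\bigotimes_{x\in\mathcal S'}\mathcal H_x$ with a finite set $\mathcal S'$ of sites, independent of $\Lambda$. $|\Omega|$ is the number of sites in $\Omega$; $\Omega$ is fixed while $N\uparrow\infty$. *)

(* Defs.v *)
From HB Require Import structures.
From mathcomp Require Import all_boot all_order all_algebra.
From mathcomp Require Import finmap sesquilinear spectral complex.
From mathcomp Require Import all_classical all_reals all_analysis.

Set Implicit Arguments.
Unset Strict Implicit.
Unset Printing Implicit Defensive.

Import Order.TTheory GRing.Theory Num.Theory.
Import numFieldNormedType.Exports.
Local Open Scope ring_scope.
Local Open Scope complex_scope.
Local Open Scope classical_set_scope.

(* The infinite lattice Z^d, and the periodic lattice (Z/L)^d with N = L^d    *)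
(* sites. 'Z_L is Z/L only when 1 < L.                                        *)
Notation latt d := {ffun 'I_d -> int}.
Notation site d L := {ffun 'I_d -> 'Z_L}.

Definition wrap_site (d L : nat) (x : latt d) : site d L := [ffun i => (x i)%:~R].

(* The Hilbert space of a finite set T of sites is the T-fold tensor power of *)
(* C^q, with the product basis indexed by configurations s : T -> 'I_q. A     *)
(* vector is a column of coordinates and an operator is its matrix, both      *)
(* indexed through the enumeration of the configurations.                     *)
Notation conf T q := {ffun T -> 'I_q}.
Notation hvec R T q := 'cV[R[i]]_#|{ffun T -> 'I_q}|.
Notation hop R T q := 'M[R[i]]_#|{ffun T -> 'I_q}|.

Section HilbertSpace.
Variable (R : realType).

Definition braket n (u v : 'cV[R[i]]_n) : R[i] := \sum_i (u i ord0)^* * v i ord0.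

Definition hnorm n (u : 'cV[R[i]]_n) : R := Num.sqrt (complex.Re (braket u u)).

Definition opnorm n (B : 'M[R[i]]_n) : R :=
  sup [set hnorm (B *m u) | u in [set u : 'cV[R[i]]_n | hnorm u <= 1]].

Definition expect n (u : 'cV[R[i]]_n) (B : 'M[R[i]]_n) : R[i] :=
  braket u (B *m u).

(* The library's eigenvectors are rows v with v *m M = a *: v, hence the      *)
(* transpose.                                                                 *)
Definition two_lowest n (H : 'M[R[i]]_n) (E0 E1 EG : R)
    (Phi0 Phi1 : 'cV[R[i]]_n) : Prop :=
  [/\ E0 < E1,
      [/\ hnorm Phi0 = 1, H *m Phi0 = E0%:C *: Phi0 &
          \rank (eigenspace H^T E0%:C) = 1%N],
      [/\ hnorm Phi1 = 1, H *m Phi1 = E1%:C *: Phi1 &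
          \rank (eigenspace H^T E1%:C) = 1%N] &
      forall E' : R, eigenvalue H^T E'%:C -> E' != E0 -> E' != E1 ->
        EG <= E' - E1].

End HilbertSpace.

Section LocalOperators.
Variables (R : realType) (d q : nat).

(* The operator a (x) 1 on the periodic lattice, for a acting on the sites of *)
(* S. It is meaningful when wrap_site is injective on S, which for a given S holds *)
(* as soon as L is large enough.                                              *)
Definition embed (L : nat) (S : {fset latt d}) (a : hop R S q) :
    hop R (site d L) q :=
  let restr (s : conf (site d L) q) : conf S q :=
    [ffun u : S => s (wrap_site L (val u))] in
  \matrix_(i, j)
    let s : conf (site d L) q := enum_val i in
    let t : conf (site d L) q := enum_val j in
    if [forall y : site d L,
          [exists u : S, wrap_site L (val u) == y] || (s y == t y)]
    then a (enum_rank (restr s)) (enum_rank (restr t)) else 0.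

(* Conjugation by the unitary U_x with (U_x s) y = s (y - x): an operator     *)
(* acting on the sites of S is carried to one acting on S + x.                *)
Definition translate (L : nat) (x : site d L) (B : hop R (site d L) q) :
    hop R (site d L) q :=
  let shift (s : conf (site d L) q) : conf (site d L) q :=
    [ffun y : site d L => s (y + x)] in
  \matrix_(i, j)
    B (enum_rank (shift (enum_val i))) (enum_rank (shift (enum_val j))).

Definition sum_lattice (L : nat) (S : {fset latt d}) (a : hop R S q) :
    hop R (site d L) q :=
  \sum_(x : site d L) translate x (embed L a).

Definition sum_region (L : nat) (Om : {fset latt d}) (S : {fset latt d})
    (a : hop R S q) : hop R (site d L) q :=
  \sum_(x <- Om) translate (wrap_site L x) (embed L a).

End LocalOperators.

Section SymmetryBreakingState.
Variable (R : realType).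

Definition Psi_state n (O : 'M[R[i]]_n) (Phi0 : 'cV[R[i]]_n) : 'cV[R[i]]_n :=
  ((hnorm (O *m Phi0))^-1)%:C *: (O *m Phi0).

Definition Xi_state n (O : 'M[R[i]]_n) (Phi0 : 'cV[R[i]]_n) : 'cV[R[i]]_n :=
  ((Num.sqrt 2)^-1)%:C *: (Phi0 + Psi_state O Phi0).

(* Real for self-adjoint B, so that taking the real part loses nothing.       *)
Definition variance_in n (u : 'cV[R[i]]_n) (B : 'M[R[i]]_n) : R :=
  complex.Re (expect u (B *m B) - expect u B ^+ 2).

Definition lim_or_limsup (u : nat -> R) : \bar R :=
  if `[< cvgn u >] then (limn u)%:E else limn_esup (EFin \o u).

End SymmetryBreakingState.

(* The filter |Omega| --> oo on the finite subsets Omega of Z^d.              *)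
Definition card_infty (d : nat) : set_system {fset latt d} :=
  filter_from [set: nat] (fun K => [set Om | (K <= #|` Om|)%N]).
Arguments card_infty d _ : clear implicits.

(* Main.v *)
Require Import Defs.
From HB Require Import structures.
From mathcomp Require Import all_boot all_order all_algebra.
From mathcomp Require Import finmap sesquilinear spectral complex.
From mathcomp Require Import all_classical all_reals all_analysis.
From mathcomp Require Import ring lra.
Import Order.TTheory GRing.Theory Num.Theory.
Import numFieldNormedType.Exports.
Local Open Scope ring_scope.
Local Open Scope complex_scope.

(* Write m = |Omega|, B = A_Omega and k = ||O Phi0||. For a self-adjoint X,   *)
(* <X Phi0, (H - E0) X Phi0> is half the expectation of [X, [H, X]] in Phi0,  *)
(* so the gap bounds the component of X Phi0 off the span of Phi0 and Phi1.   *)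
(* With X = O this makes Psi nearly parallel to Phi1; with X = B it gives     *)
(* B Phi0 = al Phi0 + be Psi + r with r small; with X = O^2, the third moment *)
(* excluding a component along Psi, it makes O Psi / k nearly Phi0. Since     *)
(* [B, O] is small against k, B Psi is nearly O B Phi0 / k, that is           *)
(* al Psi + be Phi0, and Phi0 + Psi is nearly an eigenvector of B, with       *)
(* eigenvalue al + be. By locality the double commutators are of order N, m   *)
(* and N^3, which leaves B a variance of order m.                             *)

(** Everything follows from one inequality, uniform in the volume: once the lattice is large
    compared with Omega, the variance of A_Omega in Xi is at most C |Omega|, with C independent of
    Omega and of the lattice ([variance_region_le]). Division by |Omega|^2 leaves C / |Omega|, which
    bounds the inner limit or limsup and tends to 0.

    A variance is at most the squared distance from B Xi to any multiple of Xi ([variance_in_le]),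
    so it is enough that Xi be an approximate eigenvector. [Xi_state_residual] writes the defect
    exactly as four terms, and [variance_Xi_state_le] shows each to be of order sqrt m. The gap
    enters through [gap_double_commutator]; long range order enters as k >= mu o N, so that each
    division by k compensates a factor O, whose norm is of order N. [pair_decomposition] replaces
    the unknown Phi1 by the explicit Psi.

    Locality is read off matrix entries. Operators with disjoint supports commute
    ([supported_commute]), a translate meets boundedly many others ([card_near]), and a local
    operator has boundedly many nonzero entries per row and column, hence a norm bound independent
    of the lattice ([op_bounded_sparse_mx]). *)

Set Implicit Arguments.
Unset Strict Implicit.
Unset Printing Implicit Defensive.

(** * The Hermitian inner product on column vectors *)

Section InnerProduct.
Variables (R : realType) (n : nat).
Implicit Types (u v w : 'cV[R[i]]_n) (B C : 'M[R[i]]_n).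

Lemma hermsymmxP B :
  reflect (forall i j, B i j = Num.conj (B j i)) (B \is hermsymmx).
Proof.
apply: (iffP (is_hermitianmxP _ _ _)) => [BE i j|BE].
  by rewrite [in LHS]BE expr0 scale1r !mxE.
by apply/matrixP => i j; rewrite expr0 scale1r !mxE.
Qed.

Lemma braketDr u v w : braket u (v + w) = braket u v + braket u w.
Proof. by rewrite /braket -big_split; apply: eq_bigr => i _; rewrite mxE mulrDr. Qed.

Lemma braketZr a u v : braket u (a *: v) = a * braket u v.
Proof. by rewrite /braket mulr_sumr; apply: eq_bigr => i _; rewrite mxE mulrCA. Qed.

Lemma conj_braket u v : Num.conj (braket u v) = braket v u.
Proof.
rewrite /braket rmorph_sum; apply: eq_bigr => i _.
by rewrite rmorphM /= conjCK mulrC.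
Qed.

Lemma braketDl u v w : braket (u + v) w = braket u w + braket v w.
Proof. by rewrite -conj_braket braketDr rmorphD /= !conj_braket. Qed.

Lemma braketZl a u v : braket (a *: u) v = Num.conj a * braket u v.
Proof. by rewrite -conj_braket braketZr rmorphM /= !conj_braket. Qed.

Lemma braketNr u v : braket u (- v) = - braket u v.
Proof. by rewrite -scaleN1r braketZr mulN1r. Qed.

Lemma braketNl u v : braket (- u) v = - braket u v.
Proof. by rewrite -conj_braket braketNr rmorphN /= conj_braket. Qed.

Lemma braketBr u v w : braket u (v - w) = braket u v - braket u w.
Proof. by rewrite braketDr braketNr. Qed.

Lemma braketBl u v w : braket (u - v) w = braket u w - braket v w.
Proof. by rewrite braketDl braketNl. Qed.

Lemma braket0r u : braket u 0 = 0.
Proof. by rewrite -(subrr 0) braketBr subrr. Qed.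

Lemma braket_mulmxl B u v :
  B \is hermsymmx -> braket (B *m u) v = braket u (B *m v).
Proof.
move=> /hermsymmxP BE; rewrite /braket.
under eq_bigr do rewrite mxE rmorph_sum mulr_suml.
rewrite exchange_big /=; apply: eq_bigr => j _.
rewrite mxE mulr_sumr; apply: eq_bigr => i _.
by rewrite rmorphM /= -BE -mulrA mulrCA.
Qed.

Lemma braket_ge0 u : 0 <= braket u u.
Proof. by apply: sumr_ge0 => i _; rewrite mulrC mul_conjC_ge0. Qed.

Lemma braketuu u : braket u u = (hnorm u ^+ 2)%:C.
Proof.
have /andP[/eqP im0 re0]: (complex.Im (braket u u) == 0) &&
    (0 <= complex.Re (braket u u)) by have := braket_ge0 u; rewrite lecE.
by rewrite /hnorm sqr_sqrtr // [LHS]complexE im0 mulr0 addr0.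
Qed.

Lemma hnorm_ge0 u : 0 <= hnorm u.
Proof. exact: sqrtr_ge0. Qed.

Lemma hnorm0_eq0 u : hnorm u = 0 -> u = 0.
Proof.
move=> u0; have /eqP := braketuu u; rewrite u0 expr0n /=.
rewrite psumr_eq0 => [|i _]; last by rewrite mulrC mul_conjC_ge0.
move=> /allP uE; apply/matrixP => i j; rewrite ord1 mxE.
by have /= := uE i (mem_index_enum _); rewrite mulrC mul_conjC_eq0 => /eqP.
Qed.

Lemma hnorm_scale a u : hnorm (a *: u) = Normc.normc a * hnorm u.
Proof.
rewrite /hnorm braketZr braketZl mulrA braketuu -normCK normc_def.
rewrite -rmorphXn -rmorphM /=.
by rewrite sqrtrM ?sqr_ge0// !sqrtr_sqr !ger0_norm ?sqrtr_ge0//; case: a.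
Qed.

Lemma hnorm_scaleR (a : R) u : hnorm (a%:C *: u) = `|a| * hnorm u.
Proof. by rewrite hnorm_scale /= expr0n /= addr0 sqrtr_sqr. Qed.

Lemma hnorm_opp u : hnorm (- u) = hnorm u.
Proof. by rewrite /hnorm braketNl braketNr opprK. Qed.

Lemma hnorm0 : hnorm (0 : 'cV[R[i]]_n) = 0.
Proof. by rewrite /hnorm braket0r sqrtr0. Qed.

Lemma normc_ge0 (z : R[i]) : 0 <= Normc.normc z.
Proof. by case: z => a b; apply: sqrtr_ge0. Qed.

Lemma ler_Re_normc (z : R[i]) : complex.Re z <= Normc.normc z.
Proof.
case: z => a b /=; apply: le_trans (ler_norm a) _.
by rewrite -sqrtr_sqr; apply: ler_wsqrtr; rewrite lerDl sqr_ge0.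
Qed.

Lemma normc_conjM (z : R[i]) : Num.conj z * z = (Normc.normc z ^+ 2)%:C.
Proof. by rewrite mulrC -normCK normc_def rmorphXn; case: z. Qed.

(** Pythagoras. Cauchy-Schwarz, the variance formula and the exchange of Phi1 for Psi all rest on
    this identity. *)
Lemma hnormB_proj u v : hnorm u = 1 ->
  hnorm (v - braket u v *: u) ^+ 2 = hnorm v ^+ 2 - Normc.normc (braket u v) ^+ 2.
Proof.
move=> u1; apply: complexI; rewrite -braketuu rmorphB /= -normc_conjM -braketuu.
rewrite braketBl !braketBr !braketZr !braketZl (braketuu u) u1 expr1n mulr1.
by rewrite conj_braket; ring.
Qed.

Lemma cauchy_schwarz u v : Normc.normc (braket u v) <= hnorm u * hnorm v.
Proof.
have [u0|u0] := eqVneq (hnorm u) 0.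
  rewrite u0 mul0r (hnorm0_eq0 u0) -conj_braket braket0r rmorph0.
  by rewrite Normc.normc0.
have up : 0 < hnorm u by rewrite lt_def u0 hnorm_ge0.
pose w := ((hnorm u)^-1)%:C *: u.
have w1 : hnorm w = 1 by rewrite hnorm_scaleR ger0_norm ?invr_ge0 ?hnorm_ge0 // mulVf.
have := sqr_ge0 (hnorm (v - braket w v *: w)).
rewrite hnormB_proj // subr_ge0 ler_sqr ?nnegrE ?hnorm_ge0 ?normc_ge0 //.
rewrite braketZl Normc.normcM.
have -> : Normc.normc (Num.conj ((hnorm u)^-1)%:C) = (hnorm u)^-1.
  rewrite conj_Creal; last by rewrite complex_real.
  by rewrite /= expr0n addr0 sqrtr_sqr ger0_norm ?invr_ge0 ?hnorm_ge0.
by rewrite ler_pdivrMl.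
Qed.

Lemma ler_hnormD u v : hnorm (u + v) <= hnorm u + hnorm v.
Proof.
rewrite -ler_sqr ?nnegrE ?addr_ge0 ?hnorm_ge0 //.
have -> : hnorm (u + v) ^+ 2 =
    hnorm u ^+ 2 + complex.Re (braket u v) *+ 2 + hnorm v ^+ 2.
  apply: complexI; rewrite -braketuu 2!rmorphD rmorphMn /= -!braketuu.
  rewrite -mulr_natl -addcJ braketDl !braketDr.
  have -> : (braket u v)^*%C = braket v u by apply: conj_braket.
  by ring.
have := le_trans (ler_Re_normc _) (cauchy_schwarz u v).
by rewrite sqrrD !mulr2n; lra.
Qed.

End InnerProduct.

(** * Operator bounds and the algebra of commutators *)

Section OperatorBound.
Variables (R : realType) (n : nat).
Implicit Types (u v w : 'cV[R[i]]_n) (A B C : 'M[R[i]]_n) (b c : R).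

(** An inequality on every vector, rather than a supremum, so that bounds add and multiply directly;
    [b] need not be optimal. *)
Definition op_bounded B b := forall u, hnorm (B *m u) <= b * hnorm u.

Definition commutator B C := B *m C - C *m B.

Lemma op_boundedW B b c : b <= c -> op_bounded B b -> op_bounded B c.
Proof.
by move=> bc Bb u; apply: le_trans (Bb u) _; rewrite ler_wpM2r ?hnorm_ge0.
Qed.

Lemma op_bounded0 : op_bounded 0 0.
Proof. by move=> u; rewrite mul0mx hnorm0 mul0r. Qed.

Lemma op_boundedD B C b c :
  op_bounded B b -> op_bounded C c -> op_bounded (B + C) (b + c).
Proof.
move=> Bb Cc u; rewrite mulmxDl mulrDl; apply: le_trans (ler_hnormD _ _) _.
by rewrite lerD.
Qed.

Lemma op_boundedN B b : op_bounded B b -> op_bounded (- B) b.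
Proof. by move=> Bb u; rewrite mulNmx hnorm_opp. Qed.

Lemma op_boundedM B C b c : 0 <= b ->
  op_bounded B b -> op_bounded C c -> op_bounded (B *m C) (b * c).
Proof.
move=> b0 Bb Cc u; rewrite -mulmxA -mulrA; apply: le_trans (Bb _) _.
by rewrite ler_wpM2l.
Qed.

Lemma op_bounded_commutator B C b c : 0 <= b -> 0 <= c ->
  op_bounded B b -> op_bounded C c -> op_bounded (commutator B C) (2 * b * c).
Proof.
move=> b0 c0 Bb Cc; have -> : 2 * b * c = b * c + c * b by ring.
by apply/op_boundedD/op_boundedN; apply: op_boundedM.
Qed.

Lemma op_bounded_sum (I : Type) (r : seq I) (P : pred I)
    (F : I -> 'M[R[i]]_n) (f : I -> R) :
  (forall i, P i -> op_bounded (F i) (f i)) ->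
  op_bounded (\sum_(i <- r | P i) F i) (\sum_(i <- r | P i) f i).
Proof.
move=> Ff; apply: (big_ind2 (fun B b => op_bounded B b)) => //.
  exact: op_bounded0.
by move=> *; apply: op_boundedD.
Qed.

Lemma commutator_suml (I : Type) (r : seq I) (P : pred I)
    (F : I -> 'M[R[i]]_n) C :
  commutator (\sum_(i <- r | P i) F i) C =
  \sum_(i <- r | P i) commutator (F i) C.
Proof. by rewrite /commutator mulmx_suml mulmx_sumr -sumrB. Qed.

Lemma commutator_sumr (I : Type) (r : seq I) (P : pred I)
    (F : I -> 'M[R[i]]_n) B :
  commutator B (\sum_(i <- r | P i) F i) =
  \sum_(i <- r | P i) commutator B (F i).
Proof. by rewrite /commutator mulmx_suml mulmx_sumr -sumrB. Qed.

Lemma commutatorMr B C A :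
  commutator A (B *m C) = commutator A B *m C + B *m commutator A C.
Proof. by rewrite /commutator mulmxBl mulmxBr !mulmxA addrA subrK. Qed.

Lemma commutatorMl B C A :
  commutator (B *m C) A = B *m commutator C A + commutator B A *m C.
Proof. by rewrite /commutator mulmxBl mulmxBr !mulmxA addrA subrK. Qed.

Lemma commutatorDr B C A :
  commutator A (B + C) = commutator A B + commutator A C.
Proof. by rewrite /commutator mulmxDl mulmxDr opprD addrACA. Qed.

Lemma commutatorxx B : commutator B B = 0.
Proof. exact: subrr. Qed.

Lemma hermsymmxM B C : B \is hermsymmx -> C \is hermsymmx ->
  B *m C = C *m B -> B *m C \is hermsymmx.
Proof.
move=> /hermsymmxP Bh /hermsymmxP Ch BC; apply/hermsymmxP => i j.
rewrite [in RHS]BC !mxE rmorph_sum; apply: eq_bigr => k _.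
by rewrite rmorphM /= -Bh -Ch mulrC.
Qed.

Lemma hermsymmx_sum (I : Type) (r : seq I) (P : pred I) (F : I -> 'M[R[i]]_n) :
  (forall i, F i \is hermsymmx) -> \sum_(i <- r | P i) F i \is hermsymmx.
Proof.
move=> Fh; apply/hermsymmxP => i j; rewrite !summxE rmorph_sum.
by apply: eq_bigr => k _; apply/hermsymmxP.
Qed.

End OperatorBound.

(** * Consequences of the gap above the two lowest levels *)

Section SpectralGap.
Variables (R : realType) (n : nat).
Implicit Types (u v w : 'cV[R[i]]_n) (B C H : 'M[R[i]]_n).

Lemma eigenvector_unique H (a : R[i]) u v : \rank (eigenspace H^T a) = 1%N ->
  u != 0 -> H *m u = a *: u -> H *m v = a *: v -> exists c, v = c *: u.
Proof.
move=> rk1 u0 Hu Hv.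
have sub_eig w : H *m w = a *: w -> (w^T <= eigenspace H^T a)%MS.
  by move=> Hw; apply/eigenspaceP; rewrite -trmx_mul Hw linearZ.
have ru : \rank u^T = 1%N.
  by rewrite rank_rV -(inj_eq trmx_inj) trmxK trmx0 u0.
have /leqifP := mxrank_leqif_sup (sub_eig u Hu).
case: ifPn => [uE _|_]; last by rewrite ru rk1.
have /sub_rVP[c vc] := submx_trans (sub_eig v Hv) uE.
by exists c; apply: trmx_inj; rewrite vc linearZ.
Qed.

(** The spectral theorem in coordinates. Reading the coordinates of [P *m v] as components along the
    eigenvectors [e k] lets the gap be argued coordinate by coordinate. *)
Lemma hermitian_diagonalization H : H \is hermsymmx ->
  exists (P : 'M[R[i]]_n) (sp : 'I_n -> R) (e : 'I_n -> 'cV[R[i]]_n),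
  [/\ forall u v, braket (P *m u) (P *m v) = braket u v,
      forall v k, (P *m (H *m v)) k ord0 = (sp k)%:C * (P *m v) k ord0,
      forall v k, (P *m v) k ord0 = braket (e k) v &
      forall k, e k != 0 /\ H *m e k = (sp k)%:C *: e k].
Proof.
move=> Hh; have /orthomx_spectralP HE := hermitian_normalmx Hh.
have spR k : spectral_diag H ord0 k = (complex.Re (spectral_diag H ord0 k))%:C.
  by rewrite RRe_real //; have /mxOverP := hermitian_spectral_diag_real Hh.
set sp := spectral_diag H in HE spR; set P := spectralmx H in HE.
have Pu : P \is unitarymx := spectral_unitarymx H.
have PU : P \in unitmx by apply: unitarymx_unit.
have HP : P *m H = diag_mx sp *m P by rewrite [in LHS]HE -mulmxA mulKVmx.
pose e k : 'cV_n := \col_j Num.conj (P k j).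
have PE v k : (P *m v) k ord0 = braket (e k) v.
  by rewrite mxE; apply: eq_bigr => j _; rewrite mxE conjCK.
exists P, (fun k => complex.Re (sp ord0 k)), e; split=> //.
- move=> u v; rewrite /braket.
  under eq_bigr do rewrite [X in Num.conj X]mxE rmorph_sum mulr_suml.
  rewrite exchange_big /=; apply: eq_bigr => j _.
  have -> : v j ord0 = (invmx P *m (P *m v)) j ord0 by rewrite mulKmx.
  rewrite invmx_unitary // mxE mulr_sumr; apply: eq_bigr => i _.
  by rewrite rmorphM /= !mxE -mulrA mulrCA.
- by move=> v k; rewrite mulmxA HP -mulmxA mul_diag_mx mxE -spR.
- move=> k; have eE : e k = invmx P *m delta_mx k ord0.
    apply/matrixP => i j; rewrite invmx_unitary // !mxE (bigD1 k) //=.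
    rewrite !mxE !eqxx ord1 eqxx mulr1 big1 ?addr0 // => l /negPf lk.
    by rewrite !mxE lk mulr0.
  split.
    apply/eqP => e0; have : P *m e k = delta_mx k ord0 by rewrite eE mulKVmx.
    rewrite e0 mulmx0 => /matrixP/(_ k ord0); rewrite !mxE !eqxx => /esym/eqP.
    by rewrite oner_eq0.
  apply: (can_inj (mulKmx PU)); rewrite mulmxA HP -mulmxA -scalemxAr.
  rewrite eE mulKVmx // mul_diag_mx; apply/matrixP => i j; rewrite !mxE -spR.
  by case: eqVneq => [->|]; rewrite //= !mulr0.
Qed.

Lemma two_lowest_orth H E0 E1 EG (u0 u1 : 'cV[R[i]]_n) :
  H \is hermsymmx -> two_lowest H E0 E1 EG u0 u1 -> braket u0 u1 = 0.
Proof.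
move=> Hh [E01 [_ H0 _] [_ H1 _] _].
have := braket_mulmxl u0 u1 Hh; rewrite H0 H1 braketZl braketZr.
rewrite conj_Creal ?complex_real // => /eqP; rewrite -subr_eq0 -mulrBl.
rewrite -rmorphB mulf_eq0 => /orP[/eqP/complexI E|/eqP//].
by move: E01; rewrite -subr_gt0 -opprB E oppr0 ltxx.
Qed.

(** For orthonormal [u0] and [u1], the component of [v] orthogonal to their span. *)
Definition off_pair (u0 u1 v : 'cV[R[i]]_n) :=
  v - braket u0 v *: u0 - braket u1 v *: u1.

(** In an eigenbasis the right-hand side is the sum of (sp k - E0) |v_k|^2. By nondegeneracy the
    eigenvectors for E0 and E1 are multiples of [u0] and [u1], along which [off_pair] has no
    component; every other level lies at least EG above E1 > E0. *)
Lemma gap_off_pair H E0 E1 EG (u0 u1 : 'cV[R[i]]_n) v :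
  H \is hermsymmx -> two_lowest H E0 E1 EG u0 u1 ->
  EG * hnorm (off_pair u0 u1 v) ^+ 2
    <= complex.Re (braket v (H *m v)) - E0 * hnorm v ^+ 2.
Proof.
move=> Hh HT; have u01 := two_lowest_orth Hh HT.
have u10 : braket u1 u0 = 0 by rewrite -conj_braket u01 rmorph0.
case: HT => E01 [n0 H0 rk0] [n1 H1 rk1] gap.
have nz (u : 'cV[R[i]]_n) : hnorm u = 1 -> u != 0.
  by move=> nu; apply: contra_eq_neq nu => ->; rewrite hnorm0 eq_sym oner_eq0.
have [P [sp [e [Pu PH Pe He]]]] := hermitian_diagonalization Hh.
set w := off_pair u0 u1 v.
have w0 : braket u0 w = 0.
  rewrite /w /off_pair !braketBr !braketZr u01 (braketuu u0) n0 expr1n !mulr1.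
  by rewrite mulr0 subrr subr0.
have w1 : braket u1 w = 0.
  rewrite /w /off_pair !braketBr !braketZr u10 (braketuu u1) n1 expr1n mulr1.
  by rewrite mulr0 subr0 subrr.
have Pk0 u E k : H *m u = E%:C *: u -> sp k != E -> (P *m u) k ord0 = 0.
  move=> Hu spE; have := PH u k; rewrite Hu -scalemxAr mxE => /eqP.
  rewrite -subr_eq0 -mulrBl -rmorphB mulf_eq0 => /orP[/eqP/complexI/eqP|/eqP//].
  by rewrite subr_eq0 eq_sym (negPf spE).
have key k : (EG%:C * (Num.conj ((P *m w) k ord0) * (P *m w) k ord0) <=
    (sp k - E0)%:C * (Num.conj ((P *m v) k ord0) * (P *m v) k ord0))%R.
  have nn (z : R[i]) : 0 <= Num.conj z * z by rewrite mulrC mul_conjC_ge0.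
  have [ek0 Hek] := He k.
  have [spE0|spE0] := eqVneq (sp k) E0.
    rewrite spE0 in Hek; have [c ec] := eigenvector_unique rk0 (nz _ n0) H0 Hek.
    by rewrite (Pe w) ec braketZl w0 !mulr0 spE0 subrr mul0r.
  have [spE1|spE1] := eqVneq (sp k) E1.
    have E01' : 0 <= (sp k - E0)%:C by rewrite ler0c subr_ge0 spE1 ltW.
    rewrite spE1 in Hek; have [c ec] := eigenvector_unique rk1 (nz _ n1) H1 Hek.
    by rewrite (Pe w) ec braketZl w1 !mulr0 mulr_ge0.
  have eigk : eigenvalue H^T (sp k)%:C.
    apply/eigenvalueP; exists (e k)^T; first by rewrite -trmx_mul Hek linearZ.
    by rewrite -(inj_eq trmx_inj) trmxK trmx0.
  have := gap _ eigk spE0 spE1 => gapk.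
  have -> : (P *m w) k ord0 = (P *m v) k ord0.
    rewrite /w /off_pair !mulmxBr -!scalemxAr.
    have := Pk0 _ _ _ H0 spE0; have := Pk0 _ _ _ H1 spE1.
    by rewrite !mxE => -> ->; rewrite !mulr0 !subr0.
  by apply: ler_wpM2r => //; rewrite lecR; lra.
have : (EG%:C * braket w w <= braket v (H *m v) - E0%:C * braket v v)%R.
  rewrite -(Pu w w) -(Pu v v) -(Pu v (H *m v)) /braket !mulr_sumr -sumrB.
  apply: ler_sum => k _; apply: le_trans (key k) _.
  by rewrite PH rmorphB /= mulrBl mulrCA.
rewrite !braketuu -!rmorphM /= lecE => /andP[_] /=.
by rewrite raddfB.
Qed.

(** On [u0] the outer factors H become E0, so the double commutator has expectation twice the excess
    energy of [B *m u0]. *)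
Lemma gap_double_commutator H E0 E1 EG (u0 u1 : 'cV[R[i]]_n) B c :
  H \is hermsymmx -> two_lowest H E0 E1 EG u0 u1 -> B \is hermsymmx ->
  op_bounded (commutator B (commutator H B)) c ->
  EG * hnorm (off_pair u0 u1 (B *m u0)) ^+ 2 <= c / 2.
Proof.
move=> Hh HT Bh Dc; apply: le_trans (gap_off_pair _ Hh HT) _.
case: HT => _ [n0 H0 _] _ _.
set D := commutator _ _ in Dc.
have : complex.Re (braket u0 (D *m u0)) <= c.
  apply: le_trans (ler_Re_normc _) _; apply: le_trans (cauchy_schwarz _ _) _.
  by have := Dc u0; rewrite n0 mul1r mulr1.
suff -> : complex.Re (braket u0 (D *m u0)) = 2 *
  (complex.Re (braket (B *m u0) (H *m (B *m u0))) - E0 * hnorm (B *m u0) ^+ 2).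
  by move=> ?; rewrite ler_pdivlMr // mulrC.
have -> : braket u0 (D *m u0) =
   (braket (B *m u0) (H *m (B *m u0)) - E0%:C * braket (B *m u0) (B *m u0)) *+ 2.
  rewrite /D /commutator !mulmxBr !mulmxBl !braketBr -!mulmxA.
  rewrite -(braket_mulmxl u0 _ Hh) H0.
  rewrite -!scalemxAr !braketZl !braketZr !(braket_mulmxl _ _ Bh).
  rewrite conj_Creal ?complex_real // mulr2n.
  by ring.
by rewrite raddfMn raddfB /= braketuu -rmorphM /= mulr_natl.
Qed.

End SpectralGap.

(** * Ingredients for the approximate eigenvector *)

Section SymmetryBreaking.
Variables (R : realType) (n : nat).
Implicit Types (u v w : 'cV[R[i]]_n) (B C H O : 'M[R[i]]_n).

(** The variance is the squared distance from [B *m u] to the line of [u], attained at the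
    expectation of [B]. *)
Lemma variance_in_le u B (l : R[i]) : hnorm u = 1 -> B \is hermsymmx ->
  0 <= variance_in u B <= hnorm (B *m u - l *: u) ^+ 2.
Proof.
move=> u1 Bh; set z := expect u B.
have zR : Num.conj z = z by rewrite conj_braket braket_mulmxl.
have -> : variance_in u B = hnorm (B *m u - z *: u) ^+ 2.
  rewrite hnormB_proj // -/z; apply: complexI.
  rewrite rmorphB /= -braketuu -normc_conjM -/z /variance_in.
  rewrite /expect -mulmxA -(braket_mulmxl _ _ Bh) -/(expect u B) -/z.
  rewrite expr2 -[X in _ - X * _]zR raddfB /= braketuu normc_conjM.
  by rewrite -rmorphB.
rewrite sqr_ge0 /=.
have -> : B *m u - z *: u =
    (B *m u - l *: u) - braket u (B *m u - l *: u) *: u.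
  rewrite braketBr braketZr -/(expect u B) -/z braketuu u1 expr1n mulr1.
  by rewrite scalerBl opprB addrA addrNK.
by rewrite (hnormB_proj _ u1) gerBl sqr_ge0.
Qed.

(** Expand [v] along [u0] and [u1], then project [u1] onto [p]; hence b = <u1, v> <p, u1>. The error
    of the projection has the norm of [off_pair u0 u1 p], both squares being 1 - |<u1, p>|^2. *)
Lemma pair_decomposition (u0 u1 p v : 'cV[R[i]]_n) :
  hnorm u1 = 1 -> hnorm p = 1 -> braket u0 p = 0 ->
  exists2 b : R[i], Normc.normc b <= hnorm v &
    hnorm (v - braket u0 v *: u0 - b *: p)
      <= hnorm (off_pair u0 u1 v) + hnorm v * hnorm (off_pair u0 u1 p).
Proof.
move=> n1 np u0p.
have u1v : Normc.normc (braket u1 v) <= hnorm v.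
  by have := cauchy_schwarz u1 v; rewrite n1 mul1r.
have pu1 : Normc.normc (braket p u1) <= 1.
  by have := cauchy_schwarz p u1; rewrite n1 np mulr1.
exists (braket u1 v * braket p u1).
  rewrite Normc.normcM -[leRHS]mulr1.
  by apply: ler_pM => //; apply: normc_ge0.
have -> : v - braket u0 v *: u0 - (braket u1 v * braket p u1) *: p =
    off_pair u0 u1 v + braket u1 v *: (u1 - braket p u1 *: p).
  by rewrite scalerBr scalerA addrA subrK.
apply: le_trans (ler_hnormD _ _) _; rewrite lerD2l hnorm_scale.
have -> : hnorm (off_pair u0 u1 p) = hnorm (u1 - braket p u1 *: p).
  apply/eqP; rewrite -(eqrXn2 (isT : (0 < 2)%N)) ?hnorm_ge0 //.
  rewrite /off_pair u0p scale0r subr0 !hnormB_proj // n1 np.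
  suff -> : Normc.normc (braket u1 p) = Normc.normc (braket p u1) by [].
  by rewrite -conj_braket; case: (braket p u1) => a b /=; rewrite sqrrN.
by rewrite ler_wpM2r ?hnorm_ge0.
Qed.

Lemma ler_sqrt_gap (g x y : R) : 0 < g -> 0 <= x -> g * x ^+ 2 <= y / 2 ->
  x <= Num.sqrt (y / (2 * g)).
Proof.
move=> g0 x0 gxy; rewrite -(ger0_norm x0) -sqrtr_sqr; apply: ler_wsqrtr.
by rewrite invfM mulrA ler_pdivlMr // mulrC.
Qed.

(** The commutator with O is a derivation that kills O, so [O^2, [H, O^2]] is a sum of four
    products, each of [O, [H, O]] with two factors O. *)
Lemma op_bounded_double_commutator_sqr H O (b D : R) : 0 <= b -> 0 <= D ->
  op_bounded O b -> op_bounded (commutator O (commutator H O)) D ->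
  op_bounded (commutator (O *m O) (commutator H (O *m O))) (4 * b ^+ 2 * D).
Proof.
move=> b0 D0 Ob; set DD := commutator O _ => DDb.
have -> : commutator (O *m O) (commutator H (O *m O)) =
    (O *m (DD *m O) + O *m (O *m DD)) + ((DD *m O) *m O + (O *m DD) *m O).
  rewrite commutatorMl !commutatorMr commutatorDr !commutatorMr commutatorxx.
  by rewrite -/DD mulmx0 mul0mx addr0 add0r mulmxDr mulmxDl.
have -> : 4 * b ^+ 2 * D = (b * (D * b) + b * (b * D)) + (D * b * b + b * D * b).
  by ring.
by do 2!apply: op_boundedD;
   (apply: op_boundedM; [rewrite ?mulr_ge0| |]) => //; apply: op_boundedM.
Qed.

(* [c1] bounds the part of [B Phi0] off the two lowest states in units of     *)
(* [sqrt m], and [c2] that of [Psi] in units of [1 / sqrt N].                 *)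
Definition breaking_const (g kappa b D b' D' c : R) :=
  let c1 := Num.sqrt (D' / (2 * g)) in
  let c2 := Num.sqrt (D / (2 * g)) / kappa in
  (1 + b / kappa) * (c1 + b' * c2)
  + 2 * b' * ((2 * b / kappa + (b / kappa) ^+ 2) * c2) + c / kappa.

End SymmetryBreaking.

(** * The variance in the state Xi *)

Section SymmetryBreakingState.
Variables (R : realType) (n : nat).
Implicit Types (u v w : 'cV[R[i]]_n) (B C H O : 'M[R[i]]_n).

Lemma off_pairZ (u0 u1 v : 'cV[R[i]]_n) a :
  off_pair u0 u1 (a *: v) = a *: off_pair u0 u1 v.
Proof. by rewrite /off_pair !braketZr !scalerBr !scalerA. Qed.

Lemma hnorm_Xi_state O u0 : hnorm u0 = 1 -> hnorm (O *m u0) != 0 ->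
  braket u0 (O *m u0) = 0 -> hnorm (Xi_state O u0) = 1.
Proof.
move=> n0 k0 m1; set p := Psi_state O u0.
have np : hnorm p = 1.
  by rewrite hnorm_scaleR ger0_norm ?invr_ge0 ?hnorm_ge0 // mulVf.
have u0p : braket u0 p = 0 by rewrite braketZr m1 mulr0.
have pu0 : braket p u0 = 0 by rewrite -conj_braket u0p rmorph0.
apply/eqP; rewrite -(eqrXn2 (isT : (0 < 2)%N)) ?hnorm_ge0 // expr1n; apply/eqP.
rewrite /Xi_state -/p hnorm_scaleR exprMn real_normK ?num_real //.
rewrite exprVn sqr_sqrtr //.
suff -> : hnorm (u0 + p) ^+ 2 = 2 by rewrite mulVf.
apply: complexI; rewrite -braketuu braketDl !braketDr u0p pu0 !braketuu n0 np.
by rewrite addr0 add0r -rmorphD /= expr1n.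
Qed.

(** Commute B past O in B Psi = B O u0 / k and substitute B u0 = a u0 + b Psi + r in both halves of
    Xi; what does not recombine into (a + b) Xi is listed on the right. *)
Lemma Xi_state_residual O B u0 (a b : R[i]) : hnorm (O *m u0) != 0 ->
  let k := hnorm (O *m u0) in
  let r := B *m u0 - a *: u0 - b *: Psi_state O u0 in
  B *m Xi_state O u0 - (a + b) *: Xi_state O u0 =
  ((Num.sqrt 2)^-1)%:C *: (r + (k^-1)%:C *: (O *m r)
    + b *: ((k ^- 2)%:C *: (O *m (O *m u0)) - u0)
    + (k^-1)%:C *: (commutator B O *m u0)).
Proof.
move=> k0 k r; rewrite {}/r /Xi_state /Psi_state -/k -!scalemxAr.
rewrite (scalerA (a + b)) (mulrC (a + b)) -(scalerA _ (a + b)) -scalerBr.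
congr (_ *: _).
rewrite /commutator !(mulmxBl, mulmxBr, mulmxDr, mulmxN) -!scalemxAr -!mulmxA.
have -> : (k ^- 2)%:C = (k^-1)%:C * (k^-1)%:C by rewrite -rmorphM /= -exprVn expr2.
move: (O *m (O *m u0)) (O *m (B *m u0)) (B *m (O *m u0)) => x1 x2 x3.
move: (O *m u0) (B *m u0) (k^-1)%:C => x4 x5 z.
by apply/matrixP => i j; rewrite !mxE; ring.
Qed.

Lemma variance_Xi_state_le H O B (u0 u1 : 'cV[R[i]]_n)
    (E0 E1 EG N m kappa b D b' D' c : R) :
  H \is hermsymmx -> O \is hermsymmx -> B \is hermsymmx ->
  0 < EG -> two_lowest H E0 E1 EG u0 u1 ->
  0 < kappa -> kappa * N <= hnorm (O *m u0) -> 1 <= m -> m <= N ->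
  0 <= b -> 0 <= D -> 0 <= b' -> 0 <= D' -> 0 <= c ->
  expect u0 O = 0 -> expect u0 (O *m O *m O) = 0 ->
  op_bounded O (b * N) -> op_bounded B (b' * m) ->
  op_bounded (commutator O (commutator H O)) (D * N) ->
  op_bounded (commutator B (commutator H B)) (D' * m) ->
  op_bounded (commutator B O) (c * m) ->
  0 <= variance_in (Xi_state O u0) B
    <= breaking_const EG kappa b D b' D' c ^+ 2 * m.
Proof.
move=> Hh Oh Bh g0 HT ka0 kN m1 mN b0 D0 b'0 D'0 c0 mom1 mom3 Ob Bb DO DB CB.
have n0 : hnorm u0 = 1 by case: HT => _ [].
have n1 : hnorm u1 = 1 by case: HT => _ _ [].
have m0 : 0 < m by apply: lt_le_trans m1.
have N0 : 0 < N by apply: lt_le_trans mN.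
have N0' := ltW N0; have sm0' : 0 <= (Num.sqrt m)^-1 by rewrite invr_ge0 sqrtr_ge0.
set k := hnorm (O *m u0) in kN *.
have k0 : 0 < k by apply: lt_le_trans kN; apply: mulr_gt0.
have kn0 : k != 0 by rewrite gt_eqF.
set p := Psi_state O u0.
have np : hnorm p = 1 by rewrite hnorm_scaleR ger0_norm ?invr_ge0 ?hnorm_ge0 // mulVf.
have u0p : braket u0 p = 0 by rewrite braketZr -/(expect u0 O) mom1 mulr0.
set c1 := Num.sqrt (D' / (2 * EG)).
set g1 := Num.sqrt (D / (2 * EG)).
set c2 := g1 / kappa.
set sm := Num.sqrt m; set sN := Num.sqrt N.
have sm0 : 0 < sm by rewrite sqrtr_gt0.
have smN : sm <= sN by rewrite ler_wsqrtr.
have sN0 : 0 < sN by rewrite sqrtr_gt0.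
have smE : sm ^+ 2 = m by rewrite sqr_sqrtr // ltW.
have sNE : sN ^+ 2 = N by rewrite sqr_sqrtr // ltW.
have c10 : 0 <= c1 by apply: sqrtr_ge0.
have g10 : 0 <= g1 by apply: sqrtr_ge0.
have c20 : 0 <= c2 by rewrite divr_ge0 // ltW.
have EG2 : 0 <= (2 * EG)^-1 by rewrite invr_ge0 mulr_ge0 // ltW.
have q0 : hnorm (off_pair u0 u1 (O *m u0)) <= g1 * sN.
  have := ler_sqrt_gap g0 (hnorm_ge0 _) (gap_double_commutator Hh HT Oh DO).
  by rewrite mulrAC sqrtrM // mulr_ge0.
have qB : hnorm (off_pair u0 u1 (B *m u0)) <= c1 * sm.
  have := ler_sqrt_gap g0 (hnorm_ge0 _) (gap_double_commutator Hh HT Bh DB).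
  by rewrite mulrAC sqrtrM // mulr_ge0.
have bN0 : 0 <= b * N by rewrite mulr_ge0 // ltW.
have DN0 : 0 <= D * N by rewrite mulr_ge0 // ltW.
(* The double commutator of O^2 is of order N^3, so this norm is of order N^(3/2); division by k^2
   will leave 1 / sqrt N. *)
have qO2 : hnorm (off_pair u0 u1 (O *m (O *m u0))) <= 2 * b * N * (g1 * sN).
  have Oh2 : O *m O \is hermsymmx by apply: hermsymmxM.
  have DO2 := op_bounded_double_commutator_sqr bN0 DN0 Ob DO.
  have := ler_sqrt_gap g0 (hnorm_ge0 _) (gap_double_commutator Hh HT Oh2 DO2).
  have -> : 4 * (b * N) ^+ 2 * (D * N) / (2 * EG) =
     (2 * b * N) ^+ 2 * ((D / (2 * EG)) * N) by ring.
  rewrite sqrtrM ?sqr_ge0 // sqrtr_sqr ger0_norm ?mulr_ge0 //.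
  rewrite -(mulmxA O O u0).
  rewrite (sqrtrM N) ?mulr_ge0 //.
have kV0 : 0 <= k^-1 by rewrite invr_ge0 ltW.
have kVN : k^-1 * N <= kappa^-1.
  by rewrite mulrC ler_pdivrMr // mulrC ler_pdivlMr // mulrC.
(* Here m <= N is used to relax every 1 / sqrt N to 1 / sqrt m, which is all the final bound can
   use. *)
have sNm : sN <= N / sm.
  by rewrite ler_pdivlMr // -sNE expr2 ler_wpM2l // ltW.
have qp : hnorm (off_pair u0 u1 p) <= c2 / sm.
  rewrite off_pairZ hnorm_scaleR ger0_norm //.
  apply: le_trans (ler_wpM2l kV0 q0) _.
  rewrite mulrCA /c2 -!mulrA ler_wpM2l //.
  apply: le_trans (ler_wpM2l kV0 sNm) _; rewrite mulrA ler_wpM2r //.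
have nB : hnorm (B *m u0) <= b' * m by have := Bb u0; rewrite n0 mulr1.
have nO : hnorm (O *m u0) <= b * N by have := Ob u0; rewrite n0 mulr1.
have [b1 b1B r1B] := pair_decomposition (B *m u0) n1 np u0p.
set r1 := _ - _ - _ in r1B.
have r1le : hnorm r1 <= (c1 + b' * c2) * sm.
  apply: le_trans r1B _; rewrite mulrDl; apply: lerD => //.
  have -> : b' * c2 * sm = b' * m * (c2 / sm).
    by rewrite -smE; field; rewrite gt_eqF.
  by apply: ler_pM => //; apply: hnorm_ge0.
set v2 := (k ^- 2)%:C *: (O *m (O *m u0)).
have [b2 _ r2B] := pair_decomposition v2 n1 np u0p.
(* Since <u0, O^2 u0> = k^2, the coefficient of [u0] in [v2] is exactly 1. *)
have u0v2 : braket u0 v2 = 1.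
  rewrite braketZr -(braket_mulmxl _ _ Oh) braketuu -/k -rmorphM /= mulVf //.
  by rewrite expf_neq0.
rewrite u0v2 scale1r in r2B; set r2 := _ - _ - _ in r2B.
have kV2 : 0 <= k ^- 2 by rewrite invr_ge0 sqr_ge0.
have r2le : hnorm r2 <= (2 * b / kappa + (b / kappa) ^+ 2) * c2 / sm.
  apply: le_trans r2B _; rewrite -mulrA mulrDl.
  have kVk : k ^- 2 * (N * N) <= kappa^-1 * kappa^-1.
    have -> : k ^- 2 * (N * N) = (k^-1 * N) * (k^-1 * N) by field.
    by apply: ler_pM => //; rewrite mulr_ge0 // ltW.
  apply: lerD.
    rewrite off_pairZ hnorm_scaleR ger0_norm //.
    apply: le_trans (ler_wpM2l kV2 qO2) _.
    have -> : 2 * b / kappa * (c2 / sm) = kappa^-1 * kappa^-1 * (2 * b * g1 / sm).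
      by rewrite /c2; field; rewrite !gt_eqF.
    have -> : k ^- 2 * (2 * b * N * (g1 * sN)) = k ^- 2 * N * sN * (2 * b * g1).
      by ring.
    rewrite [leRHS]mulrA [leRHS]mulrAC ler_wpM2r ?mulr_ge0 //.
    apply: le_trans (ler_wpM2l (_ : 0 <= k ^- 2 * N) sNm) _.
      by rewrite mulr_ge0 // ltW.
    by rewrite mulrA ler_wpM2r // -mulrA.
  rewrite hnorm_scaleR ger0_norm //.
  apply: ler_pM => //; rewrite ?mulr_ge0 ?hnorm_ge0 //.
  have -> : (b / kappa) ^+ 2 = b * b * (kappa^-1 * kappa^-1).
    by rewrite expr2 mulrACA.
  apply: le_trans (_ : b * b * (k ^- 2 * (N * N)) <= _); last first.
    by rewrite ler_wpM2l // mulr_ge0.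
  have -> : b * b * (k ^- 2 * (N * N)) = k ^- 2 * (b * N * (b * N)) by ring.
  rewrite ler_wpM2l //; apply: le_trans (Ob _) _.
  by rewrite ler_wpM2l.
(* The vanishing third moment makes [v2] orthogonal to [p], so the component of [r2] along [p] is
   -b2. *)
have b2le : Normc.normc b2 <= hnorm r2.
  have pv2 : braket p v2 = 0.
    rewrite /p /Psi_state /v2 braketZl braketZr (braket_mulmxl _ _ Oh) !mulmxA.
    by rewrite -/(expect u0 (O *m O *m O)) mom3 !mulr0.
  have pr2 : braket p r2 = - b2.
    rewrite !braketBr pv2 -conj_braket u0p rmorph0 braketZr braketuu np expr1n.
    by rewrite mulr1 subrr sub0r.
  have := cauchy_schwarz p r2; rewrite pr2 np mul1r.
  by case: (b2) => x y /=; rewrite !sqrrN.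
have v2u0 : hnorm (v2 - u0) <= 2 * ((2 * b / kappa + (b / kappa) ^+ 2) * c2 / sm).
  have -> : v2 - u0 = r2 + b2 *: p by rewrite /r2 subrK.
  apply: le_trans (ler_hnormD _ _) _; rewrite hnorm_scale np mulr1.
  by rewrite mulr_natl mulr2n lerD // (le_trans b2le).
set C := breaking_const _ _ _ _ _ _ _.
have XiE := Xi_state_residual B (braket u0 (B *m u0)) b1 kn0.
rewrite -/k -/p -/r1 -/v2 in XiE; cbv zeta in XiE.
have := variance_in_le (braket u0 (B *m u0) + b1) (hnorm_Xi_state n0 kn0 mom1) Bh.
move=> /andP[-> /le_trans/=]; apply.
rewrite -smE -exprMn ler_sqr ?nnegrE ?hnorm_ge0 //; last first.
  rewrite mulr_ge0 ?sqrtr_ge0 // /C /breaking_const.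
  by rewrite !(addr_ge0, mulr_ge0) ?exprn_ge0 ?divr_ge0 // ?invr_ge0 // ltW.
have XiE' : B *m Xi_state O u0 - (braket u0 (B *m u0) + b1) *: Xi_state O u0 =
  ((Num.sqrt 2)^-1)%:C *: (r1 + (k^-1)%:C *: (O *m r1) + b1 *: (v2 - u0)
    + (k^-1)%:C *: (commutator B O *m u0)) := XiE.
rewrite {}XiE' hnorm_scaleR.
have s2 : `|(Num.sqrt (2 : R))^-1| <= 1.
  rewrite ger0_norm ?invr_ge0 ?sqrtr_ge0 // invf_le1 ?sqrtr_gt0 //.
  by rewrite -[leLHS]sqrtr1 ler_wsqrtr // ler1n.
apply: le_trans (ler_wpM2r (hnorm_ge0 _) s2) _; rewrite mul1r.
rewrite /C /breaking_const -/c1 -/g1 -/c2 2!mulrDl.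
apply: le_trans (ler_hnormD _ _) (lerD _ _).
  apply: le_trans (ler_hnormD _ _) (lerD _ _).
    apply: le_trans (ler_hnormD _ _) _.
    rewrite -mulrA [leRHS]mulrDl mul1r; apply: lerD => //.
    rewrite hnorm_scaleR ger0_norm //.
    apply: le_trans (ler_wpM2l kV0 (Ob _)) _.
    have -> : k^-1 * (b * N * hnorm r1) = b * (k^-1 * N * hnorm r1) by ring.
    rewrite -[leRHS]mulrA ler_wpM2l //; apply: ler_pM; rewrite ?hnorm_ge0 //.
    by rewrite mulr_ge0.
  rewrite hnorm_scale.
  set X := _ * c2 in v2u0 *.
  have -> : 2 * b' * X * sm = b' * m * (2 * (X / sm)).
    by rewrite -smE; field; rewrite gt_eqF.
  apply: ler_pM; rewrite ?hnorm_ge0 ?normc_ge0 //.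
  exact: le_trans nB.
rewrite hnorm_scaleR ger0_norm //.
(* The commutator term is at most c m / k <= c / kappa; the factor sqrt m is then free because m >=
   1. *)
have := CB u0; rewrite n0 mulr1 => CBle.
apply: le_trans (ler_wpM2l kV0 CBle) _; rewrite mulrCA -[leRHS]mulrA ler_wpM2l //.
apply: le_trans (_ : k^-1 * N <= _); first by rewrite ler_wpM2l.
apply: le_trans kVN _; rewrite ler_peMr ?invr_ge0 ?(ltW ka0) //.
by rewrite -[leLHS]sqrtr1 ler_wsqrtr.
Qed.
End SymmetryBreakingState.

(** * Norm bounds for sparse matrices *)

Section SparseOperators.
Variables (R : realType) (n : nat).
Implicit Types (B : 'M[R[i]]_n) (e : rel 'I_n).

Lemma hnorm_sqrE (u : 'cV[R[i]]_n) :
  hnorm u ^+ 2 = \sum_i Normc.normc (u i ord0) ^+ 2.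
Proof.
apply: complexI; rewrite -braketuu rmorph_sum; apply: eq_bigr => i _.
exact: normc_conjM.
Qed.

(** A Schur-type bound: Cauchy-Schwarz in each row costs k M^2, and by symmetry of [e] each
    coordinate of [u] is met by at most k rows. *)
Lemma op_bounded_sparse_mx B e (k : nat) (M : R) : 0 <= M -> symmetric e ->
  (forall i, #|e i| <= k)%N -> (forall i j, B i j != 0 -> e i j) ->
  (forall i j, Normc.normc (B i j) <= M) -> op_bounded B (k%:R * M).
Proof.
move=> M0 e_sym e_card Be BM u.
rewrite -ler_sqr ?nnegrE ?mulr_ge0 ?hnorm_ge0 //.
pose b i : 'cV[R[i]]_n := \col_j Num.conj (B i j).
pose v i : 'cV[R[i]]_n := \col_j (if e i j then u j ord0 else 0).
have BE i : (B *m u) i ord0 = braket (b i) (v i).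
  rewrite mxE; apply: eq_bigr => j _; rewrite !mxE conjCK.
  by case: ifPn => // /(contraNT (Be i j))/eqP->; rewrite mul0r mulr0.
have bM i : hnorm (b i) ^+ 2 <= k%:R * M ^+ 2.
  rewrite hnorm_sqrE (bigID (e i)) /= addrC big1 ?add0r => [|j].
    apply: le_trans (_ : \sum_(j | e i j) M ^+ 2 <= _).
      apply: ler_sum => j _; rewrite mxE lerXn2r ?nnegrE ?normc_ge0 //.
      by have := BM i j; case: (B i j) => x y /=; rewrite sqrrN.
    by rewrite sumr_const -[leLHS]mulr_natl ler_wpM2r ?sqr_ge0 // ler_nat.
  by move=> /(contraNT (Be i j)) /eqP Bij0; rewrite mxE Bij0 rmorph0 Normc.normc0 expr0n.
rewrite hnorm_sqrE.
apply: le_trans (_ : \sum_i (k%:R * M ^+ 2) *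
    \sum_(j | e i j) Normc.normc (u j ord0) ^+ 2 <= _).
  apply: ler_sum => i _; rewrite BE.
  apply: le_trans (_ : (hnorm (b i) * hnorm (v i)) ^+ 2 <= _).
    by rewrite lerXn2r ?nnegrE ?mulr_ge0 ?hnorm_ge0 ?normc_ge0 // cauchy_schwarz.
  rewrite exprMn; apply: ler_pM; rewrite ?sqr_ge0 //.
  rewrite hnorm_sqrE [leRHS]big_mkcond /=; apply: ler_sum => j _.
  by rewrite mxE; case: ifP => // _; rewrite Normc.normc0 expr0n.
rewrite -mulr_sumr (exchange_big_dep predT) //=.
apply: le_trans (_ : k%:R * M ^+ 2 * \sum_i k%:R * Normc.normc (u i ord0) ^+ 2 <= _).
  rewrite ler_wpM2l ?mulr_ge0 ?sqr_ge0 //; apply: ler_sum => j _.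
  rewrite sumr_const -[leLHS]mulr_natl ler_wpM2r ?sqr_ge0 // ler_nat.
  by apply: leq_trans (e_card j); rewrite leq_eqVlt; apply/orP; left;
     apply/eqP/eq_card => i; rewrite unfold_in e_sym.
rewrite -mulr_sumr -hnorm_sqrE.
by rewrite [leLHS](_ : _ = (k%:R * M * hnorm u) ^+ 2) //; ring.
Qed.

End SparseOperators.

(** * Operators supported on a set of sites *)

Section Support.
Variables (R : realType) (T : finType) (q : nat).
Implicit Types (X Y : {set T}) (s t : conf T q) (B C : hop R T q).

Definition entry B s t := B (enum_rank s) (enum_rank t).

(** The matrix of an operator on X tensored with the identity: diagonal off X, and blind to the
    common configuration there. *)
Definition supported X B :=
  (forall s t y, y \notin X -> s y != t y -> entry B s t = 0) /\
  (forall s t s' t', {in X, s =1 s'} -> {in X, t =1 t'} ->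
     {in [predC X], s =1 t} -> {in [predC X], s' =1 t'} ->
     entry B s t = entry B s' t').

Lemma entryM B C s t : entry (B *m C) s t = \sum_u entry B s u * entry C u t.
Proof.
rewrite /entry mxE (reindex (@enum_rank (conf T q))) //.
exact/onW_bij/enum_rank_bij.
Qed.

Lemma entryP B C : (forall s t, entry B s t = entry C s t) -> B = C.
Proof.
by move=> BC; apply/matrixP => i j; rewrite -(enum_valK i) -(enum_valK j); apply: BC.
Qed.

(* In a product of operators with disjoint supports the intermediate          *)
(* configuration is forced.                                                   *)
Lemma entryM_disjoint X Y B C s t : [disjoint X & Y] ->
  supported X B -> supported Y C ->
  let m : conf T q := [ffun y => if y \in X then t y else s y] in
  entry (B *m C) s t = entry B s m * entry C m t.
Proof.
move=> XY [B0 _] [C0 _] m; rewrite entryM (bigD1 m) //= big1 ?addr0 // => u um.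
have [y] : exists y, u y != m y.
  by apply/existsP; apply: contraNT um; rewrite negb_exists => /forallP um;
     apply/eqP/ffunP => y; apply/eqP; rewrite -[_ == _]negbK.
rewrite ffunE; case: ifPn => yX uy.
  by rewrite (C0 u t y) ?mulr0 // (disjointFr XY).
by rewrite (B0 s u y) ?mul0r // eq_sym.
Qed.

(** If s and t differ outside both sets, both products vanish. Otherwise the forced intermediate
    configurations are t on X, respectively on Y, and s elsewhere, and locality identifies the
    entries of each factor in the two products. *)
Lemma supported_commute X Y B C : [disjoint X & Y] ->
  supported X B -> supported Y C -> B *m C = C *m B.
Proof.
move=> XY BX CY; apply: entryP => s t.
rewrite (entryM_disjoint _ _ XY BX CY).
rewrite (entryM_disjoint _ _ _ CY BX) 1?disjoint_sym // mulrC.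
have XYF y : y \in X -> y \in Y = false by apply: disjointFr.
have YXF y : y \in Y -> y \in X = false by apply: disjointFl.
have [/existsP[y /and3P[yX yY st]]|] :=
    boolP [exists y, [&& y \notin X, y \notin Y & s y != t y]].
  have [C0 _] := CY.
  rewrite [entry C _ t](C0 _ _ y) ?ffunE ?(negPf yX) // mul0r.
  have [B0 _] := BX.
  by rewrite [entry B _ t](B0 _ _ y) ?ffunE ?(negPf yY) // mulr0.
rewrite negb_exists => /forallP st.
have stE y : y \notin X -> y \notin Y -> s y = t y.
  by move=> yX yY; apply/eqP; have := st y; rewrite yX yY negbK.
have [_ B1] := BX; have [_ C1] := CY.
congr (_ * _); [apply: C1 | apply: B1] => y; rewrite ?inE ?ffunE.
- by move=> /YXF->.
- by move=> ->.
- by case: ifPn => // yX yY; apply: stE.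
- by move=> /negPf->.
- by move=> /XYF->.
- by move=> ->.
- by move=> /negPf->.
- by case: ifPn => // yY yX; apply: stE.
Qed.

(** The base [q.+1] stays positive even for q = 0, so that the exponent may later be enlarged to the
    number of sites of S. *)
Lemma card_agree_off X s :
  (#|[pred t : conf T q | [forall y, (y \in X) || (s y == t y)]]| <= q.+1 ^ #|X|)%N.
Proof.
pose F y : pred 'I_q := fun c => (y \in X) || (s y == c).
rewrite (eq_card (_ : _ =i family F)); last by move=> t; rewrite !inE.
rewrite card_family foldrE big_image /=.
rewrite (bigID (mem X)) /= -[leqRHS]muln1; apply: leq_mul.
  apply: leq_trans (_ : \prod_(y in X) q.+1 <= _)%N; last by rewrite prod_nat_const.
  apply: leq_prod => y _; apply: leq_trans (max_card _) _.
  by rewrite card_ord.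
rewrite big1 // => y yX; rewrite -(card1 (s y)); apply: eq_card => c.
by rewrite inE -topredE /= /F (negPf yX) eq_sym.
Qed.

Lemma op_bounded_supported X B (M : R) : 0 <= M -> supported X B ->
  (forall i j, Normc.normc (B i j) <= M) ->
  op_bounded B ((q.+1 ^ #|X|)%:R * M).
Proof.
move=> M0 [B0 _] BM.
pose f s t := [forall y, (y \in X) || (s y == t y)].
apply: (op_bounded_sparse_mx (e := fun i j => f (enum_val i) (enum_val j))) => //.
- move=> i j; apply/forallP/forallP => H y; move/(_ y): H;
  by rewrite (eq_sym (enum_val i y)).
- move=> i; apply: leq_trans (card_agree_off X (enum_val i)).
  rewrite -(card_imset _ (@enum_val_inj _ predT)); apply/subset_leq_card/fintype.subsetP.
  by move=> t /imsetP[j ij ->]; rewrite inE; apply: ij.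
- move=> i j; apply: contraNT; rewrite negb_forall => /existsP[y].
  rewrite negb_or => /andP[yX st]; apply/eqP.
  by have := B0 _ _ _ yX st; rewrite /entry !enum_valK.
Qed.

End Support.

(** * Commutators of sums of local terms *)

Section SparseSums.
Variables (R : realType) (n : nat).

Lemma op_bounded_sparse_sum (I : finType) (P Q : pred I)
    (F : I -> 'M[R[i]]_n) (k : nat) (b : R) : 0 <= b ->
  (forall i, op_bounded (F i) b) -> (forall i, P i -> ~~ Q i -> F i = 0) ->
  (#|Q| <= k)%N -> op_bounded (\sum_(i | P i) F i) (k%:R * b).
Proof.
move=> b0 Fb F0 Qk; rewrite (bigID Q) /= addrC.
rewrite big1 ?add0r => [|i /andP[]]; last exact: F0.
apply: op_boundedW (_ : \sum_(i | P i && Q i) b <= _) (op_bounded_sum _ _) => //.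
rewrite sumr_const -[leLHS]mulr_natl ler_wpM2r // ler_nat.
apply: leq_trans Qk; apply/subset_leq_card/fintype.subsetP => i.
by rewrite unfold_in => /andP[].
Qed.

Lemma op_bounded_commutator_sum (I J : finType) (Om : {set I})
    (a : I -> 'M[R[i]]_n) (o : J -> 'M[R[i]]_n) (near_ao : I -> pred J)
    (k : nat) (ba bo : R) :
  0 <= ba -> 0 <= bo ->
  (forall x, op_bounded (a x) ba) -> (forall y, op_bounded (o y) bo) ->
  (forall x y, ~~ near_ao x y -> a x *m o y = o y *m a x) ->
  (forall x, #|near_ao x| <= k)%N ->
  op_bounded (commutator (\sum_(x in Om) a x) (\sum_y o y))
    (k%:R * (2 * ba * bo) * #|Om|%:R).
Proof.
move=> ba0 bo0 aB oB ao nearK; rewrite commutator_suml mulrC.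
have b0 : 0 <= k%:R * (2 * ba * bo) by rewrite !mulr_ge0.
apply: (op_bounded_sparse_sum (Q := mem Om)) => // [x|x xO /negP[]//].
rewrite commutator_sumr.
apply: (op_bounded_sparse_sum (Q := near_ao x)) => // [|y|y _ /ao].
- by rewrite !mulr_ge0.
- exact: op_bounded_commutator.
- by rewrite /commutator => ->; rewrite subrr.
Qed.

(** In [a_x, [h_y, a_z]] let z range over Om; then y must be near z, and x near z or near y, since
    otherwise a_x commutes with both. Counting in this order is linear in [#|Om|]. *)
Lemma op_bounded_double_commutator_sum (I J : finType) (Om : {set I})
    (a : I -> 'M[R[i]]_n) (h : J -> 'M[R[i]]_n) (near_aa : rel I)
    (near_ha : J -> pred I) (kaa kah kha : nat) (ba bh : R) :
  0 <= ba -> 0 <= bh ->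
  (forall x, op_bounded (a x) ba) -> (forall y, op_bounded (h y) bh) ->
  (forall x z, ~~ near_aa z x -> a x *m a z = a z *m a x) ->
  (forall y x, ~~ near_ha y x -> h y *m a x = a x *m h y) ->
  (forall z, #|near_aa z| <= kaa)%N -> (forall y, #|near_ha y| <= kha)%N ->
  (forall x, #|near_ha^~ x| <= kah)%N ->
  op_bounded (commutator (\sum_(x in Om) a x)
                (commutator (\sum_y h y) (\sum_(x in Om) a x)))
    (kah%:R * ((kaa + kha)%:R * (4 * ba ^+ 2 * bh)) * #|Om|%:R).
Proof.
move=> ba0 bh0 aB hB aa ha kaaP khaP kahP; rewrite mulrC.
have b0 : 0 <= (kaa + kha)%:R * (4 * ba ^+ 2 * bh) by rewrite !mulr_ge0.
rewrite (commutator_sumr _ _ a) commutator_sumr.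
apply: (op_bounded_sparse_sum (Q := mem Om)) => // [|z|z zO /negP[]//].
  by rewrite mulr_ge0.
rewrite (commutator_suml _ _ h) commutator_sumr.
apply: (op_bounded_sparse_sum (Q := near_ha^~ z)) => // [y|y _ /ha hz]; last first.
  by rewrite /commutator hz subrr mulmx0 mul0mx subrr.
rewrite commutator_suml.
apply: (op_bounded_sparse_sum (Q := predU (near_aa z) (near_ha y))) => [||x _|].
- by rewrite !mulr_ge0.
- move=> x; have -> : 4 * ba ^+ 2 * bh = 2 * ba * (2 * bh * ba) by ring.
  apply: op_bounded_commutator => //; first by rewrite !mulr_ge0.
  exact: op_bounded_commutator.
- rewrite !inE negb_or => /andP[/aa xz /ha yx].
  by rewrite /commutator mulmxBr mulmxBl !mulmxA -yx xz -!mulmxA -xz yx !mulmxA subrr.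
- apply: leq_trans (leq_add (kaaP z) (khaP y)).
  by rewrite -cardUI leq_addr.
Qed.

End SparseSums.

(** * Translates of local operators on the periodic lattice *)

Section Lattice.
Variables (R : realType) (d q L : nat).
Implicit Types (S : {fset latt d}) (x y : site d L) (X Y : {set site d L}).

Definition image_sites S : {set site d L} :=
  [set wrap_site L (val u) | u : S].

Definition shift_set X x : {set site d L} := [set y + x | y : site d L in X].

Lemma card_image_sites S : (#|image_sites S| <= #|` S|)%N.
Proof. by apply: leq_trans (leq_imset_card _ _) _; rewrite -cardfE. Qed.

Lemma mem_image_sites S y :
  (y \in image_sites S) = [exists u : S, wrap_site L (val u) == y].
Proof.
apply/imsetP/existsP => [[u _ ->]|[u /eqP <-]]; first by exists u.
by exists u.
Qed.

Lemma entry_embed S (a : hop R S q) s t :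
  entry (embed L a) s t =
  if [forall y, (y \in image_sites S) || (s y == t y)]
  then entry a [ffun u : S => s (wrap_site L (val u))]
               [ffun u : S => t (wrap_site L (val u))] else 0.
Proof.
rewrite /entry /embed mxE !enum_rankK.
by under eq_forallb do rewrite mem_image_sites.
Qed.

Lemma entry_translate x (B : hop R (site d L) q) s t :
  entry (translate x B) s t =
  entry B [ffun y : site d L => s (y + x)] [ffun y : site d L => t (y + x)].
Proof. by rewrite /entry mxE !enum_rankK. Qed.

Lemma supported_embed S (a : hop R S q) : supported (image_sites S) (embed L a).
Proof.
split=> [s t y yX st|s t s' t' ss' tt' st st']; rewrite !entry_embed.
  by rewrite ifF //; apply/negP => /forallP/(_ y); rewrite (negPf yX) (negPf st).
have off (u v : conf (site d L) q) : {in [predC image_sites S], u =1 v} ->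
    [forall y, (y \in image_sites S) || (u y == v y)].
  move=> uv; apply/forallP => y; case: (boolP (y \in _)) => //= yX.
  by apply/eqP/uv.
rewrite !off //; congr entry; apply/ffunP => u; rewrite !ffunE;
by [apply: ss'; apply: imset_f|apply: tt'; apply: imset_f].
Qed.

Lemma supported_translate X x (B : hop R (site d L) q) :
  supported X B -> supported (shift_set X x) (translate x B).
Proof.
move=> [B0 B1].
have inX (y : site d L) : (y + x \in shift_set X x) = (y \in X).
  by apply: (@mem_imset _ _ (fun z : site d L => z + x)); apply: addIr.
split=> [s t y yX st|s t s' t' ss' tt' st st']; rewrite !entry_translate.
  apply: (B0 _ _ (y - x)); first by rewrite -inX subrK.
  by rewrite !ffunE subrK.
by apply: B1 => y yX; rewrite !ffunE;
   [apply: ss'|apply: tt'|apply: st|apply: st']; rewrite ?inE inX.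
Qed.

Lemma commute_translate S S' (a : hop R S q) (b : hop R S' q) x y :
  [disjoint shift_set (image_sites S) x & shift_set (image_sites S') y] ->
  translate x (embed L a) *m translate y (embed L b) =
  translate y (embed L b) *m translate x (embed L a).
Proof.
by move=> /supported_commute; apply; apply/supported_translate/supported_embed.
Qed.

(** A common point u + x = v + y determines y as u + x - v, so the count does not see the size of
    the lattice. *)
Lemma card_near X Y x :
  (#|[pred y | ~~ [disjoint shift_set X x & shift_set Y y]]| <= #|X| * #|Y|)%N.
Proof.
rewrite -cardsX.
pose f (p : site d L * site d L) : site d L := p.1 + x - p.2.
apply: leq_trans (leq_imset_card f _).
apply/subset_leq_card/fintype.subsetP => y; rewrite inE => /pred0Pn[z /andP[]].
move=> /imsetP[u uX ->] /imsetP[v vY uv]; apply/imsetP; exists (u, v).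
  by rewrite inE uX vY.
by rewrite /f /= uv addrC addrA addNr add0r.
Qed.

Lemma hermsymmx_embed S (a : hop R S q) :
  a \is hermsymmx -> embed L a \is hermsymmx.
Proof.
move=> /hermsymmxP ah; apply/hermsymmxP => i j.
have enumE k l : embed L a k l = entry (embed L a) (enum_val k) (enum_val l).
  by rewrite /entry !enum_valK.
rewrite !enumE !entry_embed; set c := [forall y, _].
have -> : [forall y, (y \in image_sites S) || (enum_val j y == enum_val i y)] = c.
  by apply: eq_forallb => y; rewrite eq_sym.
by case: c; [apply: ah|rewrite rmorph0].
Qed.

Lemma hermsymmx_translate x (B : hop R (site d L) q) :
  B \is hermsymmx -> translate x B \is hermsymmx.
Proof. by move=> /hermsymmxP Bh; apply/hermsymmxP => i j; rewrite !mxE; apply: Bh. Qed.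

(** A crude norm bound, the same for all L and all translates: the sum dominates every entry, and
    the power of [q.+1] the number of nonzero entries in a row. *)
Definition local_bound S (a : hop R S q) : R :=
  (q.+1 ^ #|` S|)%:R * \sum_i \sum_j Normc.normc (a i j).

Lemma local_bound_ge0 S (a : hop R S q) : 0 <= local_bound a.
Proof.
by rewrite mulr_ge0 // sumr_ge0 // => i _; rewrite sumr_ge0 // => j _; apply: normc_ge0.
Qed.

Lemma op_bounded_local S (a : hop R S q) x :
  op_bounded (translate x (embed L a)) (local_bound a).
Proof.
have M0 : 0 <= \sum_i \sum_j Normc.normc (a i j).
  by rewrite sumr_ge0 // => i _; rewrite sumr_ge0 // => j _; apply: normc_ge0.
have aM i j : Normc.normc (a i j) <= \sum_i \sum_j Normc.normc (a i j).
  rewrite (bigD1 i) //= (bigD1 j) //= -addrA lerDl addr_ge0 //.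
    by rewrite sumr_ge0 // => k _; apply: normc_ge0.
  by rewrite sumr_ge0 // => k _; rewrite sumr_ge0 // => l _; apply: normc_ge0.
have sup := supported_translate x (supported_embed a).
apply: op_boundedW (op_bounded_supported M0 sup _) => [|i j].
  rewrite ler_wpM2r // ler_nat leq_pexp2l //.
  by apply: leq_trans (leq_imset_card _ _) (card_image_sites S).
rewrite -(enum_valK i) -(enum_valK j) -/(entry _ _ _) entry_translate entry_embed.
by case: ifP => _; [apply: aM|rewrite Normc.normc0].
Qed.

Lemma op_bounded_local_sum S (a : hop R S q) (Om : {set site d L}) :
  op_bounded (\sum_(x in Om) translate x (embed L a)) (local_bound a * #|Om|%:R).
Proof.
rewrite mulrC; apply: (op_bounded_sparse_sum (Q := mem Om)) => // [|x|x xO /negP[]//].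
  exact: local_bound_ge0.
exact: op_bounded_local.
Qed.

Definition commutator_bound S S' (a : hop R S q) (b : hop R S' q) : R :=
  (#|` S| * #|` S'|)%:R * (2 * local_bound a * local_bound b).

Lemma op_bounded_local_commutator S S' (a : hop R S q) (b : hop R S' q)
    (Om : {set site d L}) :
  op_bounded (commutator (\sum_(x in Om) translate x (embed L a)) (sum_lattice L b))
    (commutator_bound a b * #|Om|%:R).
Proof.
pose X := image_sites S; pose Y := image_sites S'.
apply: (op_bounded_commutator_sum _
  (near_ao := fun x => [pred y | ~~ [disjoint shift_set X x & shift_set Y y]])) => //.
- exact: local_bound_ge0.
- exact: local_bound_ge0.
- by move=> x; apply: op_bounded_local.
- by move=> x; apply: op_bounded_local.
- by move=> x y; rewrite negbK; apply: commute_translate.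
- move=> x; apply: leq_trans (card_near _ _ _) _.
  by apply: leq_mul; apply: card_image_sites.
Qed.

Definition double_commutator_bound S S' (a : hop R S q) (h : hop R S' q) : R :=
  (#|` S| * #|` S'|)%:R * ((#|` S| * #|` S| + #|` S'| * #|` S|)%:R *
     (4 * local_bound a ^+ 2 * local_bound h)).

Lemma op_bounded_local_double_commutator S S' (a : hop R S q) (h : hop R S' q)
    (Om : {set site d L}) :
  let A := \sum_(x in Om) translate x (embed L a) in
  op_bounded (commutator A (commutator (sum_lattice L h) A))
    (double_commutator_bound a h * #|Om|%:R).
Proof.
move=> A; pose X := image_sites S; pose Y := image_sites S'.
apply: (op_bounded_double_commutator_sum _
  (near_aa := fun x => [pred y | ~~ [disjoint shift_set X x & shift_set X y]])
  (near_ha := fun x => [pred y | ~~ [disjoint shift_set Y x & shift_set X y]])) => //.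
- exact: local_bound_ge0.
- exact: local_bound_ge0.
- by move=> x; apply: op_bounded_local.
- by move=> x; apply: op_bounded_local.
- by move=> x y; rewrite negbK => xy; apply/esym/commute_translate.
- by move=> x y; rewrite negbK; apply: commute_translate.
- move=> x; apply: leq_trans (card_near _ _ _) _.
  by apply: leq_mul; apply: card_image_sites.
- move=> x; apply: leq_trans (card_near _ _ _) _.
  by apply: leq_mul; apply: card_image_sites.
- move=> x; apply: leq_trans (leq_trans (card_near X Y x) _).
    apply/eq_leq/eq_card => y; rewrite !inE; congr (~~ _).
    by rewrite disjoint_sym.
  by apply: leq_mul; apply: card_image_sites.
Qed.

End Lattice.

(** * Fixed regions in large lattices, and the uniform variance bound *)

Section LargeVolume.
Variable (R : realType).

Lemma wrap_site_inj (d : nat) (Om : {fset latt d}) :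
  exists K, forall L, (K < L)%N -> {in Om &, injective (@wrap_site d L)}.
Proof.
pose m := (\sum_(x <- Om) \sum_i `|x i|%N)%N.
(* Coordinates of points of Om differ by at most m + m, so congruence modulo a larger L is equality.
   The successor also yields [1 < L], so that ['Z_L] is really Z/L. *)
exists (m + m).+1 => L KL x y xOm yOm xy.
have le_m z i : z \in Om -> (`|z i|%N <= m)%N.
  move=> zOm; rewrite /m (big_rem z) //= (bigD1 i) //= -addnA.
  exact: leq_addr.
apply/ffunP => i; apply/eqP; rewrite -subr_eq0 -absz_eq0.
have : ((x i - y i)%:~R : 'Z_L) = 0.
  by move/ffunP/(_ i): xy; rewrite !ffunE rmorphB /= => ->; rewrite subrr.
have lt_L : (`|x i - y i|%N < L)%N.
  apply: leq_ltn_trans (leqD_dist _ 0 _) _; rewrite subr0 sub0r abszN.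
  by apply: leq_ltn_trans (leq_add (le_m _ _ xOm) (le_m _ _ yOm)) (ltnW KL).
have nat0 (k : nat) : (k < L)%N -> (k%:R : 'Z_L) = 0 -> k = 0%N.
  have L1 : (1 < L)%N by apply: leq_ltn_trans KL.
  by move=> kL /(congr1 val) /=; rewrite Zp_nat /= Zp_cast // modn_small.
case: (x i - y i) lt_L => [k|k] kL; first by move=> /(nat0 _ kL) /= ->.
by rewrite NegzE rmorphN /= => /eqP; rewrite oppr_eq0 => /eqP/(nat0 _ kL).
Qed.

Lemma card_site_ge (d L : nat) : (0 < d)%N -> (1 < L)%N -> (L <= #|{: site d L}|)%N.
Proof.
move=> d0 L1; rewrite card_ffun !card_ord Zp_cast //.
by rewrite -[leqLHS]expn1 leq_pexp2l // ltnW.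
Qed.

Lemma sum_regionE (d q L : nat) (Om S : {fset latt d}) (a : hop R S q) :
  {in Om &, injective (@wrap_site d L)} ->
  exists2 Om' : {set site d L}, #|Om'| = #|` Om| &
    sum_region L Om a = \sum_(x in Om') translate x (embed L a).
Proof.
move=> inj; pose s := [seq wrap_site L x | x <- Om].
have s_uniq : uniq s by rewrite map_inj_in_uniq ?fset_uniq.
exists [set y in s].
  by rewrite cardsE (card_uniqP s_uniq) size_map.
have -> : sum_region L Om a = \sum_(y <- s) translate y (embed L a).
  by rewrite big_map.
rewrite big_uniq //=.
by apply: eq_bigl => y; rewrite inE.
Qed.

End LargeVolume.

Lemma variance_region_le (R : realType) (d q : nat) (d_gt0 : (0 < d)%N)
    (S S' : {fset latt d}) (ho : hop R S q) (oo : hop R [fset (0 : latt d)]%fset q)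
    (A : hop R S' q) (E0 E1 EG mu o : R) (L : nat) (Phi0 Phi1 : hvec R (site d L) q)
    (Om : {fset latt d}) :
  ho \is hermsymmx -> oo \is hermsymmx -> A \is hermsymmx -> 0 < EG ->
  0 < mu -> 0 < o -> (1 < L)%N ->
  two_lowest (sum_lattice L ho) E0 E1 EG Phi0 Phi1 ->
  expect Phi0 (sum_lattice L oo) = 0 ->
  (((mu * o * #|{: site d L}|%:R) ^+ 2)%:C
     <= expect Phi0 (sum_lattice L oo *m sum_lattice L oo))%R ->
  expect Phi0 (sum_lattice L oo *m sum_lattice L oo *m sum_lattice L oo) = 0 ->
  {in Om &, injective (@wrap_site d L)} -> (0 < #|` Om| <= L)%N ->
  0 <= variance_in (Xi_state (sum_lattice L oo) Phi0) (sum_region L Om A)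
    <= breaking_const EG (mu * o) (local_bound oo) (double_commutator_bound oo ho)
         (local_bound A) (double_commutator_bound A ho) (commutator_bound A oo) ^+ 2
       * #|` Om|%:R.
Proof.
move=> ho_sa oo_sa A_sa g0 mu0 o0 L1 HT mom1 mom2 mom3 inj /andP[Om0 OmL].
have [Om' OmE ->] := sum_regionE A inj.
have sumT (S0 : {fset latt d}) (a : hop R S0 q) :
    sum_lattice L a = \sum_(x in [set: site d L]) translate x (embed L a).
  by apply: eq_bigl => x; rewrite inE.
have herm (S0 : {fset latt d}) (a : hop R S0 q) (P : pred (site d L)) :
    a \is hermsymmx -> \sum_(x | P x) translate x (embed L a) \is hermsymmx.
  move=> ah; apply: hermsymmx_sum => x.
  exact/hermsymmx_translate/hermsymmx_embed.
have cb0 (S1 S2 : {fset latt d}) (a : hop R S1 q) (b : hop R S2 q) :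
    0 <= commutator_bound a b.
  rewrite /commutator_bound; have := local_bound_ge0 a; have := local_bound_ge0 b.
  by move: (local_bound a) (local_bound b) => x y y0 x0; rewrite !mulr_ge0.
have db0 (S1 S2 : {fset latt d}) (a : hop R S1 q) (b : hop R S2 q) :
    0 <= double_commutator_bound a b.
  rewrite /double_commutator_bound.
  have := local_bound_ge0 a; have := local_bound_ge0 b.
  move: (local_bound a) (local_bound b) => x y y0 x0.
  by rewrite !mulr_ge0 ?exprn_ge0.
have Oh : sum_lattice L oo \is hermsymmx by apply: herm.
apply: (variance_Xi_state_le (N := #|{: site d L}|%:R) (herm _ _ _ ho_sa) Oh
  (herm _ _ _ A_sa) g0 HT); rewrite ?local_bound_ge0 ?mulr_gt0 //.
(* For self-adjoint O the second moment is the squared norm of O Phi0, so long range order reads k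
   >= mu o N. *)
- rewrite -ler_sqr ?nnegrE ?hnorm_ge0 ?mulr_ge0 ?(ltW mu0) ?(ltW o0) //.
  by rewrite -lecR -braketuu braket_mulmxl // mulmxA.
- by rewrite ler1n.
- by rewrite ler_nat (leq_trans OmL) // card_site_ge.
- by have := op_bounded_local_sum oo [set: site d L]; rewrite cardsT -sumT.
- by rewrite -OmE; apply: op_bounded_local_sum.
- by have := op_bounded_local_double_commutator oo ho [set: site d L]; rewrite cardsT -sumT.
- by rewrite -OmE; apply: op_bounded_local_double_commutator.
- by rewrite -OmE; apply: op_bounded_local_commutator.
Qed.

Local Open Scope classical_set_scope.

(** * The iterated limit *)

Section Limits.
Variable (R : realType).

(** A limsup is an infimum of suprema over sets of the filter: each such set meets the set where the
    bounds hold, and that set itself gives the upper bound. *)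
Lemma lim_or_limsup_bounds (u : nat -> R) (b : R) :
  (\forall n \near \oo, 0 <= u n <= b) -> (0 <= lim_or_limsup u <= b%:E)%E.
Proof.
move=> ub; rewrite /lim_or_limsup; case: asboolP => [cu|_].
  rewrite !lee_fin; apply/andP; split.
    by apply: limr_ge => //; apply: filterS ub => n /andP[].
  by apply: limr_le => //; apply: filterS ub => n /andP[].
rewrite /limn_esup limf_esupE; apply/andP; split.
  apply: le_ereal_inf_tmp => _ [B BF <-].
  have [n [Bn /andP[un _]]] := filter_ex (filterI BF ub).
  apply: le_trans (ereal_sup_ubound (imageP _ Bn)).
  by rewrite lee_fin.
apply: le_trans (ereal_inf_lbound _) _; first by exists [set n | 0 <= u n <= b]; [exact: ub|].
by apply: ge_ereal_sup => _ [n /andP[_ un] <-]; rewrite lee_fin.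
Qed.

Lemma card_infty_filter (d : nat) : Filter (card_infty d).
Proof.
apply: filter_from_filter; first by exists 0%N.
move=> i j _ _; exists (maxn i j) => // Om /=; rewrite geq_max => /andP[iO jO].
by split.
Qed.

Lemma cvg_card_infty (d : nat) (f : {fset latt d} -> \bar R) (C : R) :
  (forall Om, (0 < #|` Om|)%N -> (0 <= f Om <= (C / #|` Om|%:R)%:E)%E) ->
  f Om @[Om --> card_infty d] --> 0%E.
Proof.
move=> fC; have FF := card_infty_filter d.
have finf Om : (0 < #|` Om|)%N -> f Om \is a fin_num.
  move=> /fC /andP[f0 fC']; rewrite ge0_fin_numE //.
  by apply: le_lt_trans fC' _; apply: ltry.
apply/fine_cvgP; split.
  by exists 1%N => // Om /= Om1; apply: finf.
apply/cvgrPdist_le => e e0.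
(* Beyond C / e sites, C / |Omega| is below e; the maximum with 1 excludes the empty region. *)
exists (maxn 1 (Num.trunc (C / e)).+1) => // Om /=.
rewrite geq_max => /andP[Om0 OmC].
have /andP[f0 fCO] := fC _ Om0.
have m0 : 0 < #|` Om|%:R :> R by rewrite ltr0n.
rewrite sub0r normrN ger0_norm ?fine_ge0 //.
rewrite -lee_fin fineK ?finf //; apply: le_trans fCO _.
rewrite lee_fin ler_pdivrMr // mulrC -ler_pdivrMr //.
apply: ltW; apply: lt_le_trans (truncnS_gt _) _; by rewrite ler_nat.
Qed.

End Limits.

Theorem theorem1 (R : realType) (d q r : nat) (d_gt0 : (0 < d)%N)
  (* the lattices: side lengths L n, tending to infinity *)
  (L : nat -> nat) (L_gt1 : forall n, (1 < L n)%N)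
  (L_oo : L n @[n --> \oo] --> \oo)
  (* h_o acts on the sites of S, o_o on the origin *)
  (S : {fset latt d}) (S_le_r : (#|` S| <= r)%N)
  (S_fits : forall n, {in S &, injective (@wrap_site d (L n))})
  (ho : hop R S q) (ho_sa : ho \is hermsymmx)
  (oo : hop R [fset (0 : latt d)]%fset q) (oo_sa : oo \is hermsymmx)
  (h o : R) (h_gt0 : 0 < h) (o_gt0 : 0 < o)
  (ho_bound : forall n (x : site d (L n)),
    opnorm (translate x (embed (L n) ho)) <= h)
  (oo_bound : forall n (x : site d (L n)),
    opnorm (translate x (embed (L n) oo)) <= o)
  (* the two lowest eigenvalues and the gap above them *)
  (E0 E1 : nat -> R) (Phi0 Phi1 : forall n, hvec R (site d (L n)) q)
  (EG : R) (EG_gt0 : 0 < EG)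
  (spectrum : forall n,
    two_lowest (sum_lattice (L n) ho) (E0 n) (E1 n) EG (Phi0 n) (Phi1 n))
  (* long range order in the ground state *)
  (mu : R) (mu_gt0 : 0 < mu)
  (moment1 : forall n, expect (Phi0 n) (sum_lattice (L n) oo) = 0)
  (moment2 : forall n,
    (((mu * o * #|{: site d (L n)}|%:R) ^+ 2)%:C
       <= expect (Phi0 n) (sum_lattice (L n) oo *m sum_lattice (L n) oo))%R)
  (moment3 : forall n,
    expect (Phi0 n) (sum_lattice (L n) oo *m sum_lattice (L n) oo *m sum_lattice (L n) oo) = 0)
  (* the local self-adjoint operator A *)
  (S' : {fset latt d}) (A : hop R S' q) (A_sa : A \is hermsymmx) :
  lim_or_limsup (fun n =>
      (#|` Om|%:R ^+ 2)^-1 *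
      variance_in (Xi_state (sum_lattice (L n) oo) (Phi0 n))
                  (sum_region (L n) Om A))
    @[Om --> card_infty d] --> 0%E.
Proof.
set C := breaking_const EG (mu * o) (local_bound oo)
  (double_commutator_bound oo ho) (local_bound A) (double_commutator_bound A ho)
  (commutator_bound A oo) ^+ 2.
apply: (cvg_card_infty (C := C)) => Om Om0.
apply: lim_or_limsup_bounds.
have [K injK] := wrap_site_inj Om.
have Ln m : \forall n \near \oo, (m <= L n)%N.
  by move/cvgnyPge: L_oo => /(_ m).
(* With [Om] fixed, [L n] eventually exceeds both the injectivity threshold and the number of its
   sites. *)
near=> n.
have KL : (K < L n)%N by near: n; apply: Ln.
have OmL : (0 < #|` Om| <= L n)%N by rewrite Om0; near: n; apply: Ln.
have /andP[v0 vC] := variance_region_le d_gt0 ho_sa oo_sa A_sa EG_gt0 mu_gt0 o_gt0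
  (L_gt1 n) (spectrum n) (moment1 n) (moment2 n) (moment3 n) (injK _ KL) OmL.
have m0 : 0 < #|` Om|%:R :> R by rewrite ltr0n.
rewrite mulr_ge0 ?invr_ge0 ?sqr_ge0 //=.
rewrite mulrC ler_pdivrMr ?exprn_gt0 // (le_trans vC) //.
by rewrite expr2 mulrA divfK // gt_eqF.
Unshelve. all: by end_near.
Qed.
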